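(* Let $A=[A_{ij}]_{i,j=1,2}$ and $B=[B_{ij}]_{i,j=1,2}$ in $M_n(\mathbb{F})$ be self-adjoint ($A^*=A$, $B^*=B$), partitioned conformally into $2\times2$ block matrices with $A_{ij},B_{ij}\in M_{n_i\times n_j}(\mathbb{F})$, $n=n_1+n_2$. If $0\leq A$, $0\leq B$, and $\ker A_{22}=\ker B_{22}$, then $$(1-t)J\operatorname{ppt}(A)+tJ\operatorname{ppt}(B)\leq J\operatorname{ppt}[(1-t)A+tB],\quad\forall t\in[0,1].$$
   Context: $\mathbb{F}=\mathbb{R}$ or $\mathbb{F}=\mathbb{C}$; $M_{p\times q}(\mathbb{F})$ is the set of $p\times q$ matrices over $\mathbb{F}$ and $M_p(\mathbb{F})=M_{p\times p}(\mathbb{F})$. $X^*$ is the (conjugate) transpose and $X^+$ the Moore-Penrose pseudoinverse of $X$. For self-adjoint $X,Y$, $X\leq Y$ (Löwner order) means $Y-X$ is positive semi-definite. For $A=\begin{bmatrix} A_{11} & A_{12} \\ A_{21} & A_{22} \end{bmatrix}\in M_n(\mathbb{F})$ with $A_{ij}\in M_{n_i\times n_j}(\mathbb{F})$, $n=n_1+n_2$, the (generalized) Schur complement is $A/A_{22}=A_{11}-A_{12}A_{22}^+A_{21}$, the (generalized) principal pivot transform is $\operatorname{ppt}(A)=\begin{bmatrix} A/A_{22} & A_{12}A_{22}^+ \\ -A_{22}^+A_{21} & A_{22}^+ \end{bmatrix}$, and $J=\begin{bmatrix} I_{n_1} & 0 \\ 0 & -I_{n_2} \end{bmatrix}$, so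 that $J\operatorname{ppt}(A)=\begin{bmatrix} A/A_{22} & A_{12}A_{22}^+ \\ A_{22}^+A_{21} & -A_{22}^+ \end{bmatrix}$. *)

(* Defs.v *)
From mathcomp Require Import all_boot all_order all_algebra.
From mathcomp Require Import sesquilinear.
From mathcomp Require Import classical_sets reals.
From mathcomp Require Import complex.

Set Implicit Arguments.
Unset Strict Implicit.
Unset Printing Implicit Defensive.
Import Order.TTheory GRing.Theory Num.Theory.
Local Open Scope ring_scope.
Local Open Scope classical_set_scope.

(* Everything is parametrized by the conjugation [theta] of the scalar field:
   [idfun] on the reals, [Num.conj] on the complex numbers. *)
Section Definitions.
Variables (F : numFieldType) (theta : F -> F).

Definition adj m n (X : 'M[F]_(m, n)) : 'M[F]_(n, m) := map_mx theta X^T.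

Definition psd n (X : 'M[F]_n) : Prop :=
  adj X = X /\ forall v : 'cV[F]_n, 0 <= (adj v *m X *m v) 0 0.

(* The Loewner order relates self-adjoint matrices only. *)
Definition lowner n (X Y : 'M[F]_n) : Prop :=
  [/\ adj X = X, adj Y = Y & psd (Y - X)].

Definition penrose m n (X : 'M[F]_(m, n)) (Y : 'M[F]_(n, m)) : Prop :=
  [/\ X *m Y *m X = X, Y *m X *m Y = Y,
      adj (X *m Y) = X *m Y & adj (Y *m X) = Y *m X].

(* Well-defined for both conjugations: see [mpinvP] and [penrose_uniq]. *)
Definition mpinv m n (X : 'M[F]_(m, n)) : 'M[F]_(n, m) :=
  xget 0 [set Y | penrose X Y].

Definition ker m n (X : 'M[F]_(m, n)) : set 'cV[F]_n := [set v | X *m v = 0].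

Definition schur n1 n2 (A : 'M[F]_(n1 + n2)) : 'M[F]_n1 :=
  ulsubmx A - ursubmx A *m mpinv (drsubmx A) *m dlsubmx A.

Definition ppt n1 n2 (A : 'M[F]_(n1 + n2)) : 'M[F]_(n1 + n2) :=
  block_mx (schur A)                              (ursubmx A *m mpinv (drsubmx A))
           (- (mpinv (drsubmx A) *m dlsubmx A))   (mpinv (drsubmx A)).

Definition signJ n1 n2 : 'M[F]_(n1 + n2) := block_mx 1%:M 0 0 (- 1%:M).

Definition Jppt n1 n2 (A : 'M[F]_(n1 + n2)) : 'M[F]_(n1 + n2) :=
  signJ n1 n2 *m ppt A.

Lemma JpptE n1 n2 (A : 'M[F]_(n1 + n2)) :
  Jppt A = block_mx (schur A) (ursubmx A *m mpinv (drsubmx A))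
                    (mpinv (drsubmx A) *m dlsubmx A) (- mpinv (drsubmx A)).
Proof.
by rewrite /Jppt mulmx_block !mul1mx !mul0mx !addr0 !add0r !mulNmx !mul1mx opprK.
Qed.

End Definitions.

Section MoorePenrose.
Variables (F : numFieldType) (theta : involutive_rmorphism F).
Local Notation adj := (adj theta).

Lemma adjM m n p (X : 'M[F]_(m, n)) (Y : 'M[F]_(n, p)) :
  adj (X *m Y) = adj Y *m adj X.
Proof. by rewrite /Defs.adj trmx_mul map_mxM. Qed.

Lemma adjK m n (X : 'M[F]_(m, n)) : adj (adj X) = X.
Proof. by apply/matrixP => i j; rewrite !mxE rmorphK. Qed.

Lemma adjV n (X : 'M[F]_n) : adj (invmx X) = invmx (adj X).
Proof. by rewrite /Defs.adj trmx_inv map_invmx. Qed.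

Lemma penrose_uniq m n (X : 'M[F]_(m, n)) (Y Z : 'M[F]_(n, m)) :
  penrose theta X Y -> penrose theta X Z -> Y = Z.
Proof.
move=> [y1 y2 y3 y4] [z1 z2 z3 z4].
have XYZ : X *m Y = X *m Z.
  have e : X *m Y = (X *m Z) *m (X *m Y) by rewrite mulmxA z1.
  have e' : X *m Z = (X *m Y) *m (X *m Z) by rewrite mulmxA y1.
  by rewrite -y3 e adjM y3 z3.
have YXZ : Y *m X = Z *m X.
  have e : Y *m X = (Y *m X) *m (Z *m X) by rewrite -mulmxA [X *m _]mulmxA z1.
  have e' : Z *m X = (Z *m X) *m (Y *m X) by rewrite -mulmxA [X *m _]mulmxA y1.
  by rewrite -y4 e adjM y4 z4.
by rewrite -y2 YXZ -mulmxA XYZ mulmxA z2.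
Qed.

Hypothesis theta_ge0 : forall x, 0 <= x * theta x.

Lemma mulmx_adj_eq0 n (v : 'rV[F]_n) : v *m adj v = 0 -> v = 0.
Proof.
move=> /matrixP/(_ 0 0); rewrite !mxE => /eqP.
rewrite psumr_eq0 => [|i _]; last by rewrite !mxE.
move=> /allP h; apply/rowP => i; rewrite mxE.
have := h i (mem_index_enum _); rewrite !mxE /= mulf_eq0 fmorph_eq0 orbb.
by move/eqP.
Qed.

Lemma row_free_gram m n (X : 'M[F]_(m, n)) :
  row_free X -> X *m adj X \in unitmx.
Proof.
move=> Xfree; rewrite -row_free_unit; apply: inj_row_free => v vG0.
have /mulmx_adj_eq0 vX0 : (v *m X) *m adj (v *m X) = 0.
  by rewrite adjM mulmxA -(mulmxA v) vG0 mul0mx.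
by apply: (row_free_inj Xfree); rewrite vX0 mul0mx.
Qed.

Lemma mpinvP m n (X : 'M[F]_(m, n)) : penrose theta X (mpinv theta X).
Proof.
suff [Y hY] : exists Y, penrose theta X Y.
  by rewrite /mpinv; case: xgetP => [Z _ //|/(_ Y)].
have [r [C [R [XE Cfull Rfree]]]] : exists r (C : 'M_(m, r)) (R : 'M_(r, n)),
    [/\ X = C *m R, row_full C & row_free R].
  exists (\rank X), (col_base X), (row_base X).
  by rewrite mulmx_base col_base_full row_base_free.
pose G := R *m adj R; pose H := adj C *m C.
have Gu : G \in unitmx by exact: row_free_gram.
have Hu : H \in unitmx.
  rewrite /H -{2}[C]adjK; apply: row_free_gram.
  by rewrite /row_free mxrank_map mxrank_tr.
have GV : adj (invmx G) = invmx G by rewrite adjV /G adjM adjK.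
have HV : adj (invmx H) = invmx H by rewrite adjV /H adjM adjK.
pose Y := adj R *m invmx G *m invmx H *m adj C.
have XY : X *m Y = C *m invmx H *m adj C.
  by rewrite XE /Y !mulmxA -(mulmxA C R) -/G mulmxK.
have YX : Y *m X = adj R *m invmx G *m R.
  by rewrite XE /Y !mulmxA -(mulmxA _ (adj C)) -/H mulmxKV.
exists Y; split.
- by rewrite XY XE !mulmxA -(mulmxA _ (adj C)) -/H mulmxKV.
- by rewrite YX /Y !mulmxA -(mulmxA _ R) -/G mulmxKV.
- by rewrite XY !adjM adjK HV mulmxA.
- by rewrite YX !adjM adjK GV mulmxA.
Qed.

End MoorePenrose.

Lemma mpinv_realP (R : realType) m n (X : 'M[R]_(m, n)) :
  penrose idfun X (mpinv idfun X).
Proof. by apply: (@mpinvP R idfun) => x; rewrite /= -expr2 sqr_ge0. Qed.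

Lemma mpinv_complexP (R : realType) m n (X : 'M[R[i]]_(m, n)) :
  penrose Num.conj X (mpinv Num.conj X).
Proof. by apply: (@mpinvP R[i] Num.conj) => x; rewrite mul_conjC_ge0. Qed.

(* Main.v *)
Require Import Defs.
From mathcomp Require Import all_boot all_order all_algebra.
From mathcomp Require Import sesquilinear.
From mathcomp Require Import classical_sets reals complex ring.

Set Implicit Arguments.
Unset Strict Implicit.
Unset Printing Implicit Defensive.
Import Order.TTheory GRing.Theory Num.Theory.
Local Open Scope ring_scope.
Local Open Scope complex_scope.

(** Write [D] for the lower right block of [A], [P] for its pseudoinverse,
    [Q = P D] for the orthogonal projection onto the complement of [ker D], and
    [q = diag (0, Q)].  Positivity gives [A12 Q = A12], so that
    [T_A = [[1, 0], [- P A21, P]]] satisfies the completion of squares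
      [T* A T - T* q - q T = J ppt A + (T - T_A)* A (T - T_A)]
    for every [T] with upper row [[1, 0]].  The left-hand side is affine in [A]
    as long as [Q] is fixed, that is, as long as [ker D] is fixed.  So
    [C = s A + t B], [s + t = 1], and the choice [T = T_C] yield
      [J ppt C - s J ppt A - t J ppt B
         = s (T_C - T_A)* A (T_C - T_A) + t (T_C - T_B)* B (T_C - T_B) >= 0]. *)

Section Concavity.
Variables (F : numFieldType) (theta : involutive_rmorphism F).
Hypothesis theta_ge0 : forall x, 0 <= x * theta x.
Local Notation adj := (adj theta).
Local Notation mpinv := (mpinv theta).
Local Notation psd := (psd theta).

(** * Algebra of the adjoint *)

Lemma adjD m n (X Y : 'M[F]_(m, n)) : adj (X + Y) = adj X + adj Y.
Proof. by rewrite /Defs.adj linearD /= map_mxD. Qed.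

Lemma adjN m n (X : 'M[F]_(m, n)) : adj (- X) = - adj X.
Proof. by rewrite /Defs.adj linearN /= map_mxN. Qed.

Lemma adjB m n (X Y : 'M[F]_(m, n)) : adj (X - Y) = adj X - adj Y.
Proof. by rewrite adjD adjN. Qed.

Lemma adjZ m n a (X : 'M[F]_(m, n)) : adj (a *: X) = theta a *: adj X.
Proof. by rewrite /Defs.adj linearZ /= map_mxZ. Qed.

Lemma adj0 m n : adj (0 : 'M[F]_(m, n)) = 0.
Proof. by rewrite /Defs.adj trmx0 map_mx0. Qed.

Lemma adj1 n : adj (1%:M : 'M[F]_n) = 1%:M.
Proof. by rewrite /Defs.adj trmx1 map_mx1. Qed.

Lemma adj_block m1 m2 n1 n2 (X : 'M[F]_(m1, n1)) (Y : 'M[F]_(m1, n2))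
    (Z : 'M[F]_(m2, n1)) (W : 'M[F]_(m2, n2)) :
  adj (block_mx X Y Z W) = block_mx (adj X) (adj Z) (adj Y) (adj W).
Proof. by rewrite /Defs.adj tr_block_mx map_block_mx. Qed.

Lemma adj_col m1 m2 n (X : 'M[F]_(m1, n)) (Y : 'M[F]_(m2, n)) :
  adj (col_mx X Y) = row_mx (adj X) (adj Y).
Proof. by rewrite /Defs.adj tr_col_mx map_row_mx. Qed.

(** * Positive semi-definite forms, their isotropic vectors and kernels *)

Lemma gram_ge0 n (u : 'cV[F]_n) : 0 <= (adj u *m u) 0 0.
Proof. by rewrite mxE sumr_ge0 // => i _; rewrite !mxE mulrC. Qed.

Lemma gram_eq0 n (u : 'cV[F]_n) : (adj u *m u) 0 0 = 0 -> u = 0.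
Proof.
move=> u0; rewrite -[u](adjK theta).
rewrite (@mulmx_adj_eq0 _ _ theta_ge0 _ (adj u)) ?adj0 // adjK.
by apply/matrixP => i j; rewrite !ord1 u0 mxE.
Qed.

Lemma adj_entry n (A : 'M[F]_n) (u v : 'cV[F]_n) :
  adj A = A -> theta ((adj u *m A *m v) 0 0) = (adj v *m A *m u) 0 0.
Proof.
move=> Ah; have -> : adj v *m A *m u = adj (adj u *m A *m v).
  by rewrite !adjM adjK Ah mulmxA.
by rewrite !mxE.
Qed.

(** If [u = A w] were nonzero, a small move from [w] along [- u] would make the form negative. The
    step [a / (1 + b)] works; scaling by [1 + b] avoids the division. *)
Lemma psd_isotropic n (A : 'M[F]_n) (w : 'cV[F]_n) :
  psd A -> (adj w *m A *m w) 0 0 = 0 -> A *m w = 0.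
Proof.
move=> [Ah Age0] w0; apply: gram_eq0; set u := A *m w.
have wA : adj w *m A = adj u by rewrite /u adjM Ah.
set a := (adj u *m u) 0 0; pose b := (adj u *m A *m u) 0 0.
have a0 : 0 <= a by exact: gram_ge0.
have b0 : 0 <= b by exact: Age0.
(* The coefficients [a] and [1 + b] have to pass through [adj] unchanged; [a] and [b] are values of
   self-adjoint forms, hence fixed by [theta]. *)
have ta : theta a = a.
  rewrite /a; have -> : adj u *m u = adj u *m 1%:M *m u by rewrite mulmx1.
  by rewrite adj_entry // adj1.
have tb : theta (1 + b) = 1 + b 
  by rewrite rmorphD rmorph1; congr (_ + _); exact: adj_entry.
(* The form at [(1 + b) w - a u] equals [- a ^ 2 (2 + b)]. *)
have := Age0 ((1 + b) *: w - a *: u).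
have -> : (adj ((1 + b) *: w - a *: u) *m A *m ((1 + b) *: w - a *: u)) 0 0
          = - (a ^+ 2 * (2 + b)).
  have uAw : (adj u *m A *m w) 0 0 = a by rewrite -mulmxA.
  have mxB (X Y : 'M[F]_1) : (X - Y) 0 0 = X 0 0 - Y 0 0 by rewrite !mxE.
  have mxZ c (X : 'M[F]_1) : (c *: X) 0 0 = c * X 0 0 by rewrite mxE.
  have wAu : (adj w *m A *m u) 0 0 = a by rewrite wA.
  rewrite adjB !adjZ ta tb !mulmxBl !mulmxBr.
  rewrite -!scalemxAl -!scalemxAr.
  rewrite !mxB !mxZ.
  rewrite w0 uAw wAu -/b !mulr0 add0r.
  by ring.
rewrite oppr_ge0 => le0.
have b2 : 0 < 2 + b by rewrite ltr_wpDr.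
move: le0; rewrite pmulr_lle0 // => le0; apply/eqP.
by rewrite -sqrf_eq0 eq_le le0 exprn_ge0.
Qed.

Lemma psd_congr m n (A : 'M[F]_m) (X : 'M[F]_(m, n)) :
  psd A -> psd (adj X *m A *m X).
Proof.
move=> [Ah Age0]; split; first by rewrite !adjM adjK Ah mulmxA.
by move=> v; have := Age0 (X *m v); rewrite adjM !mulmxA.
Qed.

Lemma psdD n (A B : 'M[F]_n) : psd A -> psd B -> psd (A + B).
Proof.
move=> [Ah A0] [Bh B0]; split=> [|v]; first by rewrite adjD Ah Bh.
by rewrite mulmxDr mulmxDl mxE addr_ge0.
Qed.

Lemma psdZ n a (A : 'M[F]_n) : 0 <= a -> theta a = a -> psd A -> psd (a *: A).
Proof.
move=> a0 ta [Ah A0]; split=> [|v]; first by rewrite adjZ Ah ta.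
by rewrite -scalemxAr -scalemxAl mxE mulr_ge0.
Qed.

Lemma ker_mulmx m n p q (D : 'M[F]_(m, n)) (E : 'M[F]_(p, n))
    (X : 'M[F]_(n, q)) :
  (ker D `<=` ker E)%classic -> D *m X = 0 -> E *m X = 0.
Proof.
move=> sDE DX0; apply/matrixP => i j.
have /sDE : ker D (col j X) by rewrite /ker /= colE mulmxA DX0 mul0mx.
by move=> /matrixP/(_ i 0); rewrite colE mulmxA -colE !mxE.
Qed.

(** On the kernel of the sum two nonnegative terms add up to 0, so both vanish; a nonzero weight
    then makes the vector isotropic for [A] or for [B]. *)
Lemma ker_psd_comb n (A B : 'M[F]_n) s t :
  psd A -> psd B -> 0 <= s -> 0 <= t -> s + t = 1 -> ker A = ker B ->
  ker (s *: A + t *: B) = ker A.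
Proof.
move=> pA pB s0 t0 st kAB; apply/seteqP; split=> v; last first.
  move=> vA; have vB : ker B v by rewrite -kAB.
  move: vA vB; rewrite /ker /= => vA vB.
  by rewrite mulmxDl -!scalemxAl vA vB !scaler0 addr0.
rewrite {1}/ker /= => vC.
have : s * (adj v *m A *m v) 0 0 + t * (adj v *m B *m v) 0 0 = 0.
  transitivity ((adj v *m (s *: A + t *: B) *m v) 0 0).
    by rewrite mulmxDr mulmxDl -!scalemxAr -!scalemxAl !mxE.
  by rewrite -mulmxA vC mulmx0 mxE.
move/eqP; rewrite paddr_eq0 ?mulr_ge0 ?(pA.2 v) ?(pB.2 v) //.
rewrite !mulf_eq0 => /andP[/orP[/eqP s00|/eqP vA] hB]; last first.
  by rewrite /ker /=; exact: psd_isotropic.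
(* For [s = 0] the weight [t] is 1, so [v] is isotropic for [B]. *)
move: hB; rewrite s00 add0r in st; rewrite st oner_eq0 /= => /eqP vB.
by rewrite kAB /ker /=; exact: psd_isotropic.
Qed.

(** * Pseudoinverses of self-adjoint matrices *)

Section HermitianPseudoinverse.
Variables (n : nat) (D : 'M[F]_n).
Hypothesis Dh : adj D = D.

(** Taking adjoints permutes the Penrose equations of a self-adjoint [D], so uniqueness applies. *)
Lemma adj_mpinv : adj (mpinv D) = mpinv D.
Proof.
apply: (@penrose_uniq _ theta _ _ D); last exact: mpinvP.
case: (mpinvP theta_ge0 D); move: (mpinv D) => P h1 h2 h3 h4.
split.
- by have := congr1 (@Defs.adj _ theta _ _) h1; rewrite !adjM Dh mulmxA.
- by have := congr1 (@Defs.adj _ theta _ _) h2; rewrite !adjM Dh mulmxA.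
- have -> : D *m adj P = P *m D by rewrite -h4 adjM Dh.
  exact: h4.
- have -> : adj P *m D = D *m P by rewrite -h3 adjM Dh.
  exact: h3.
Qed.

Lemma mpinvC : D *m mpinv D = mpinv D *m D.
Proof.
have [_ _ h3 _] := mpinvP theta_ge0 D.
by rewrite -h3 adjM Dh adj_mpinv.
Qed.

(** The columns of [1 - P D] lie in [ker D], so [E] kills them. *)
Lemma mulmx_mpinvK m (E : 'M[F]_(m, n)) :
  (ker D `<=` ker E)%classic -> E *m (mpinv D *m D) = E.
Proof.
have [h1 _ _ _] := mpinvP theta_ge0 D.
move=> sDE; have : E *m (1%:M - mpinv D *m D) = 0.
  by apply: ker_mulmx sDE _; rewrite mulmxBr mulmx1 mulmxA h1 subrr.
by rewrite mulmxBr mulmx1 => /subr0_eq.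
Qed.

End HermitianPseudoinverse.

(** Each projection absorbs the other on its right; self-adjointness turns one of these identities
    around. *)
Lemma mpinv_proj_ker n (D E : 'M[F]_n) :
  adj D = D -> adj E = E -> ker D = ker E -> mpinv D *m D = mpinv E *m E.
Proof.
move=> Dh Eh kDE.
have [_ _ _ hD] := mpinvP theta_ge0 D; have [_ _ _ hE] := mpinvP theta_ge0 E.
have DE : (mpinv D *m D) *m (mpinv E *m E) = mpinv D *m D.
  by rewrite -mulmxA mulmx_mpinvK // kDE.
have ED : (mpinv E *m E) *m (mpinv D *m D) = mpinv E *m E.
  by rewrite -mulmxA mulmx_mpinvK // kDE.
by rewrite -hD -DE adjM hD hE ED.
Qed.

(** * Block matrices and the completion of squares *)

Section CompletionOfSquares.
Variables (n1 n2 : nat).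
Implicit Types A B T : 'M[F]_(n1 + n2).

Lemma adj_submx A : adj A = A ->
  [/\ adj (ulsubmx A) = ulsubmx A, adj (ursubmx A) = dlsubmx A,
      adj (dlsubmx A) = ursubmx A & adj (drsubmx A) = drsubmx A].
Proof.
rewrite -{1 2}[A]submxK adj_block => /eq_block_mx[-> h ? ->].
by split=> //; rewrite -h.
Qed.

Lemma psd_drsubmx A : psd A -> psd (drsubmx A).
Proof.
move=> [Ah A0]; have [_ _ _ Dh] := adj_submx Ah; split=> // v.
have := A0 (col_mx 0 v); rewrite -{1}[A]submxK adj_col adj0 mul_row_block.
by rewrite !mul0mx !add0r mul_row_col mulmx0 add0r.
Qed.

(** For [v] in the kernel of the corner, the vector [(0, v)] is isotropic for [A], hence killed by
    all of [A]. *)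
Lemma psd_ker_block A :
  psd A -> (ker (drsubmx A) `<=` ker (ursubmx A))%classic.
Proof.
move=> pA v; rewrite /ker /= => Dv.
have AE : A *m col_mx 0 v = col_mx (ursubmx A *m v) 0.
  by rewrite -{1}[A]submxK mul_block_col !mulmx0 !add0r Dv.
have : A *m col_mx 0 v = 0.
  apply: psd_isotropic => //.
  by rewrite -mulmxA AE adj_col mul_row_col adj0 mul0mx mulmx0 addr0 mxE.
by rewrite AE -(col_mx0 F n1 n2 1) => /eq_col_mx[].
Qed.

Definition ker_proj A : 'M[F]_(n1 + n2) :=
  block_mx 0 0 0 (mpinv (drsubmx A) *m drsubmx A).

(** The matrix [T_A], at which the square in [Jppt_square] vanishes. *)
Definition minimizer A : 'M[F]_(n1 + n2) :=
  block_mx 1%:M 0 (- (mpinv (drsubmx A) *m dlsubmx A)) (mpinv (drsubmx A)).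

Lemma adj_ker_proj A : adj (ker_proj A) = ker_proj A.
Proof.
have [_ _ _ hD] := mpinvP theta_ge0 (drsubmx A).
by rewrite adj_block hD !adj0.
Qed.

Lemma adj_Jppt A : adj A = A -> adj (Jppt theta A) = Jppt theta A.
Proof.
move=> Ah; have [h1 h2 h3 h4] := adj_submx Ah.
rewrite JpptE adj_block /schur adjN adjB !adjM (adj_mpinv h4) h1 h2 h3.
by rewrite mulmxA.
Qed.

(** With [S] the upper row of [Jppt theta A], one has [A T_A = S + q] and [T* S = S]; hence the
    cross terms of the square depend on [T] only through [q]. *)
Lemma Jppt_square A T :
  psd A -> usubmx T = row_mx 1%:M 0 ->
  adj T *m A *m T - adj T *m ker_proj A - ker_proj A *m T
  = Jppt theta A + adj (T - minimizer A) *m A *m (T - minimizer A).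
Proof.
move=> pA uT; have Ah : adj A = A by case: pA.
have [h1 h2 h3 Dh] := adj_submx Ah.
have [p1 p2 p3 p4] := mpinvP theta_ge0 (drsubmx A).
have Ph := adj_mpinv Dh; have PC := mpinvC Dh.
set S := block_mx (schur theta A) (ursubmx A *m mpinv (drsubmx A)) 0
           (0 : 'M_n2).
have AT : A *m minimizer A = S + ker_proj A.
  (* The adjoint of [A12 Q = A12]. *)
  have DPA21 : drsubmx A *m mpinv (drsubmx A) *m dlsubmx A = dlsubmx A.
    rewrite -h2 -p3 -adjM; congr (adj _); rewrite PC.
    by apply: mulmx_mpinvK => //; exact: psd_ker_block.
  rewrite -{1}[A]submxK mulmx_block add_block_mx !mulmx1 !mulmx0.
  rewrite !mulmxN !mulmxA.
  by rewrite DPA21 subrr !add0r !addr0 PC.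
have TS U : usubmx U = row_mx 1%:M 0 -> adj U *m S = S.
  move=> uU; rewrite -[U]vsubmxK uU -[dsubmx U]hsubmxK -block_mxEv.
  rewrite adj_block adj1 adj0 mulmx_block !mulmx0 !mul0mx !mul1mx.
  by rewrite !addr0.
have uTA : usubmx (minimizer A) = row_mx 1%:M 0.
  by rewrite /minimizer block_mxEv col_mxKu.
(* The lower row comes from [P D P = P]. *)
have JE : Jppt theta A = S - ker_proj A *m minimizer A.
  rewrite JpptE mulmx_block !mul0mx !add0r !mulmxN.
  by rewrite opp_block_mx add_block_mx !mulmxA p2 !oppr0 opprK !addr0 !add0r.
have TAA : adj (minimizer A) *m A = adj S + ker_proj A.
  by rewrite -{2}Ah -adjM AT adjD adj_ker_proj.
have ST U : usubmx U = row_mx 1%:M 0 -> adj S *m U = adj S.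
  by move=> uU; rewrite -{1}[U](adjK theta) -adjM TS.
rewrite JE adjB !(mulmxBl, mulmxBr) -[_ *m A *m minimizer A]mulmxA TAA AT.
rewrite !mulmxDl !mulmxDr !ST // !TS //.
move: (adj T *m A *m T) (adj T *m ker_proj A) (ker_proj A *m T) => X1 X2 X3.
move: (ker_proj A *m minimizer A) (adj S) => X4 X5.
by apply/matrixP => i j; rewrite !mxE; ring.
Qed.

Lemma Jppt_concave A B s t :
  psd A -> psd B -> ker (drsubmx A) = ker (drsubmx B) ->
  0 <= s -> 0 <= t -> s + t = 1 -> theta s = s -> theta t = t ->
  lowner theta (s *: Jppt theta A + t *: Jppt theta B)
               (Jppt theta (s *: A + t *: B)).
Proof.
move=> pA pB kAB s0 t0 st ts tt; set C := s *: A + t *: B.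
have pC : psd C by apply: psdD; apply: psdZ.
have [Ah Bh Ch] : [/\ adj A = A, adj B = B & adj C = C].
  by case: pA; case: pB; case: pC.
have [[_ _ _ DAh] [_ _ _ DBh]] := (adj_submx Ah, adj_submx Bh).
have [_ _ _ DCh] := adj_submx Ch.
(* Equal kernels give [A], [B] and [C] the same [q], so that its terms cancel in the final
   combination. *)
have qAB : ker_proj B = ker_proj A.
  by rewrite /ker_proj (mpinv_proj_ker DAh DBh kAB).
have qAC : ker_proj C = ker_proj A.
  rewrite /ker_proj (@mpinv_proj_ker _ (drsubmx C) (drsubmx A)) //.
  have -> : drsubmx C = s *: drsubmx A + t *: drsubmx B.
    by apply/matrixP => i j; rewrite !mxE.
  by apply: ker_psd_comb => //; exact: psd_drsubmx.
split; [by rewrite adjD !adjZ ts tt !adj_Jppt | exact: adj_Jppt |].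
set T := minimizer C.
have uT : usubmx T = row_mx 1%:M 0.
  by rewrite /T /minimizer block_mxEv col_mxKu.
have -> : Jppt theta C - (s *: Jppt theta A + t *: Jppt theta B) =
    s *: (adj (T - minimizer A) *m A *m (T - minimizer A)) +
    t *: (adj (T - minimizer B) *m B *m (T - minimizer B)).
  have := Jppt_square pA uT; have := Jppt_square pB uT.
  (* At [T = T_C] the square for [C] is zero, so [Jppt theta C] is the left-hand side itself. *)
  have := Jppt_square pC uT; rewrite subrr mulmx0 addr0 qAB qAC => <-.
  move=> /(canLR (addKr _)) <- /(canLR (addKr _)) <-.
  have -> : s = 1 - t by rewrite -st addrK.
  have -> : adj T *m C *m T
      = (1 - t) *: (adj T *m A *m T) + t *: (adj T *m B *m T).
    by rewrite /C -[in RHS]st addrK mulmxDr mulmxDl -!scalemxAr -!scalemxAl.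
  move: (adj T *m A *m T) (adj T *m B *m T) (ker_proj A *m T)
    (adj T *m ker_proj A) => X1 X2 X3 X4.
  move: (Jppt theta A) (Jppt theta B) => Y1 Y2.
  by apply/matrixP => i j; rewrite !mxE; ring.
by apply: psdD; apply: psdZ => //; exact: psd_congr.
Qed.

End CompletionOfSquares.
End Concavity.

(** * The real and the complex case *)

Theorem theorem10 (R : realType) (n1 n2 : nat) :
  (forall A B : 'M[R]_(n1 + n2),
     adj idfun A = A -> adj idfun B = B ->
     lowner idfun 0 A -> lowner idfun 0 B ->
     ker (drsubmx A) = ker (drsubmx B) ->
     forall t : R, 0 <= t <= 1 ->
       lowner idfun
         ((1 - t) *: Jppt idfun A + t *: Jppt idfun B)
         (Jppt idfun ((1 - t) *: A + t *: B)))
  /\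
  (forall A B : 'M[R[i]]_(n1 + n2),
     adj Num.conj A = A -> adj Num.conj B = B ->
     lowner Num.conj 0 A -> lowner Num.conj 0 B ->
     ker (drsubmx A) = ker (drsubmx B) ->
     forall t : R, 0 <= t <= 1 ->
       lowner Num.conj
         ((1 - t)%:C *: Jppt Num.conj A + t%:C *: Jppt Num.conj B)
         (Jppt Num.conj ((1 - t)%:C *: A + t%:C *: B))).
Proof.
split=> A B _ _ [_ _]; rewrite subr0 => pA [_ _]; rewrite subr0 => pB kAB t.
  move=> /andP[t0 t1].
  apply: (@Jppt_concave _ idfun) => //; rewrite ?subr_ge0 ?subrK //.
  by move=> x; rewrite /= -expr2 sqr_ge0.
move=> /andP[t0 t1].
(* Nonnegative complex weights are real, hence fixed by conjugation. *)
have tC : 0 <= t%:C by rewrite ler0c.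
have uC : 0 <= (1 - t)%:C by rewrite ler0c subr_ge0.
apply: (@Jppt_concave _ Num.conj) => //.
- by move=> x; rewrite mul_conjC_ge0.
- by rewrite -rmorphD subrK.
- by rewrite /= conj_Creal ?ger0_real.
- by rewrite /= conj_Creal ?ger0_real.
Qed.
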